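(* Let $B,C$ be integrable cones. A function $f:\mathcal{B}B\to C$ is totally monotonic if and only if it is $n$-increasing from $B$ to $C$ for all $n\in\mathbb{N}$.
   Context: Cones. A precone is a module $P$ over $\mathbb{R}_{\ge 0}$ with $x_1+x=x_2+x\Rightarrow x_1=x_2$ and $x_1+x_2=0\Rightarrow x_1=0$, ordered by $x\le y$ iff $y=x+z$ for some (then unique) $z$, written $z=y-x$. A cone is a precone with $\|\cdot\|:P\to\mathbb{R}_{\ge0}$ such that $\|\lambda x\|=\lambda\|x\|$, $\|x\|=0\Rightarrow x=0$, $\|x+y\|\le\|x\|+\|y\|$, $\|x\|\le\|x+y\|$, and every increasing sequence in $\mathcal{B}P=\{x:\|x\|\le 1\}$ has a lub in $P$ lying in $\mathcal{B}P$. (Integrable cones are cones equipped with additional measurability and integration structure, which plays no role here beyond the cone structure.) Local cone: for $x\in\mathcal{B}B$, the local cone $B_x$ has underlying set $\{u\in B:\exists\epsilon>0,\ x+\epsilon u\in\mathcal{B}B\}$ with the operations of $B$ and norm $\|u\|_{B_x}=\inf\{1/\lambda:\lambda>0,\ x+\lambda u\in\mathcal{B}B\}$; thus $\mathcal{B}B_x=\{u\in B: x+u\in\mathcal{B}B\}$; it is again a cone. Total monotonicity: for $n\in\mathbb{N}$, let $\mathcal{P}^+_n$ (resp. $\mathcal{P}^-_n$) be the set of $I\subseteq\{1,\dots,n\}$ with $n-|I|$ even (resp. odd). A function $f:\mathcal{B}B\to C$ is totally monotonic if for all $n$ and all $x,u_1,\dots,u_n\in B$ with $x+\sum_{i=1}^n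 u_i\in\mathcal{B}B$, $\sum_{I\in\mathcal{P}^-_n}f(x+\sum_{i\in I}u_i)\le\sum_{I\in\mathcal{P}^+_n}f(x+\sum_{i\in I}u_i)$. $n$-increasing (defined by induction on $n$): $f:\mathcal{B}B\to C$ is $0$-increasing if it is increasing; for $n>0$, $f$ is $n$-increasing if it is increasing and for every $u\in\mathcal{B}B$ the function $\Delta f_u:\mathcal{B}B_u\to C$, $x\mapsto f(x+u)-f(x)$, is $(n-1)$-increasing from $B_u$ to $C$. *)

(* Defs.v *)
From HB Require Import structures.
From mathcomp Require Import all_boot all_order all_algebra.
From mathcomp Require Import boolp classical_sets reals.

Set Implicit Arguments.
Unset Strict Implicit.
Unset Printing Implicit Defensive.

Import Order.TTheory GRing.Theory Num.Theory.
Local Open Scope classical_set_scope.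
Local Open Scope ring_scope.

Record nnreal (R : realType) := NNReal {
  nnval :> R;
  _ : nnval \is Num.nneg }.

Section nnreal_semiring.
Variable R : realType.
HB.instance Definition _ := [isSub for @nnval R].
HB.instance Definition _ := [Choice of nnreal R by <:].
HB.instance Definition _ := [SubChoice_isSubComNzSemiRing of nnreal R by <:].
End nnreal_semiring.

HB.mixin Record isPrecone (R : realType) P of GRing.LSemiModule (nnreal R) P := {
  precone_addIr : forall x x1 x2 : P, x1 + x = x2 + x -> x1 = x2 ;
  precone_add_eq0 : forall x1 x2 : P, x1 + x2 = 0 -> x1 = 0 }.

#[short(type="preconeType")]
HB.structure Definition Precone (R : realType) :=
  { P of GRing.LSemiModule (nnreal R) P & isPrecone R P }.

Definition cle (R : realType) (P : preconeType R) (x y : P) : Prop :=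
  exists z, y = x + z.

(* [csub y x] is the unique [z] with [y = x + z] when [cle x y], and the junk
   value 0 otherwise. *)
Definition csub (R : realType) (P : preconeType R) (y x : P) : P :=
  xget 0 [set z | y = x + z].

HB.mixin Record Precone_isCone (R : realType) P of Precone R P := {
  cnorm : P -> R ;
  cnorm_ge0 : forall x, 0 <= cnorm x ;
  cnormZ : forall (a : nnreal R) x, cnorm (a *: x) = nnval a * cnorm x ;
  cnorm_eq0 : forall x, cnorm x = 0 -> x = 0 ;
  cnormD : forall x y, cnorm (x + y) <= cnorm x + cnorm y ;
  cnorm_le : forall x y, cnorm x <= cnorm (x + y) ;
  cone_lub : forall s : nat -> P,
    (forall n, cle (s n) (s n.+1)) -> (forall n, cnorm (s n) <= 1) ->
    exists l, [/\ forall n, cle (s n) l,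
                  forall y, (forall n, cle (s n) y) -> cle l y
                & cnorm l <= 1] }.

#[short(type="coneType")]
HB.structure Definition Cone (R : realType) :=
  { P of Precone R P & Precone_isCone R P }.

Record cball (R : realType) (B : coneType R) := CBall {
  cball_val :> B;
  _ : cnorm cball_val <= 1 }.
HB.instance Definition _ (R : realType) (B : coneType R) :=
  [isSub for @cball_val R B].

Section local_cone.
Variables (R : realType) (B : coneType R).

Lemma cball_norm (x : cball B) : cnorm (x : B) <= 1.
Proof. by case: x. Qed.

Lemma cle_norm (x y : B) : cle x y -> cnorm x <= cnorm y.
Proof. by case=> z ->; exact: cnorm_le. Qed.

Definition local_pred (x : cball B) : pred B := fun u =>
  `[< exists2 e : nnreal R, 0 < nnval e & cnorm ((x : B) + e *: u) <= 1 >].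

Lemma nnval_ge0 (a : nnreal R) : 0 <= nnval a.
Proof. by case: a. Qed.

Let mk (r : R) (h : 0 <= r) : nnreal R := NNReal (h : r \is Num.nneg).

Lemma cnorm0 : cnorm (0 : B) = 0.
Proof. by rewrite -(scale0r (0 : B)) cnormZ mul0r. Qed.

Let shrink (x u : B) (e d : nnreal R) : nnval d <= nnval e ->
  cnorm (x + e *: u) <= 1 -> cnorm (x + d *: u) <= 1.
Proof.
move=> de; apply: le_trans.
have h : 0 <= nnval e - nnval d by rewrite subr_ge0.
have -> : e = d + mk h by apply: val_inj; rewrite /= addrC subrK.
by rewrite scalerDl addrA cnorm_le.
Qed.

Let convex (x u v : B) (d e t : nnreal R) :
  0 < nnval d -> 0 < nnval e -> nnval t = ((nnval d)^-1 + (nnval e)^-1)^-1 ->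
  cnorm (x + d *: u) <= 1 -> cnorm (x + e *: v) <= 1 ->
  cnorm (x + t *: (u + v)) <= 1.
Proof.
move=> d0 e0 tE hu hv.
set S := (nnval d)^-1 + (nnval e)^-1 in tE.
have S0 : 0 < S by rewrite addr_gt0 // invr_gt0.
have ha : 0 <= (nnval d)^-1 / S by rewrite divr_ge0 ?invr_ge0 // ltW.
have hb : 0 <= (nnval e)^-1 / S by rewrite divr_ge0 ?invr_ge0 // ltW.
have ab1 : mk ha + mk hb = 1.
  by apply: val_inj; rewrite /= -mulrDl divff // gt_eqF.
have -> : x + t *: (u + v) = mk ha *: (x + d *: u) + mk hb *: (x + e *: v).
  rewrite !scalerDr !scalerA addrACA -scalerDl ab1 scale1r.
  by congr (_ + (_ *: _ + _ *: _)); apply: val_inj => /=;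
     rewrite mulrAC mulVf ?mul1r ?gt_eqF.
apply: le_trans (cnormD _ _) _; rewrite !cnormZ.
have -> : 1 = nnval (mk ha) + nnval (mk hb) by rewrite -[LHS]/(nnval 1) -ab1.
by apply: lerD; rewrite ler_piMr // nnval_ge0.
Qed.

Lemma local_pred_closed (x : cball B) : subsemimod_closed (local_pred x).
Proof.
split; first split.
- apply/asboolP; exists 1; first by rewrite /= ltr01.
  by rewrite scaler0 addr0 cball_norm.
- move=> u v /asboolP[d d0 hu] /asboolP[e e0 hv]; apply/asboolP.
  have h : 0 <= ((nnval d)^-1 + (nnval e)^-1)^-1.
    by rewrite invr_ge0 addr_ge0 // invr_ge0 nnval_ge0.
  exists (mk h) => /=; first by rewrite invr_gt0 addr_gt0 // invr_gt0.
  exact: (convex d0 e0 _ hu hv).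
- move=> a u /asboolP[e e0 hu]; apply/asboolP.
  have [a0|a0] := eqVneq (nnval a) 0.
    exists 1; first by rewrite /= ltr01.
    have -> : a = 0 by apply: val_inj.
    by rewrite scale0r scaler0 addr0 cball_norm.
  have h : 0 <= nnval e / nnval a by rewrite divr_ge0 ?nnval_ge0.
  have ap : 0 < nnval a by rewrite lt0r a0 nnval_ge0.
  exists (mk h); first by rewrite /= divr_gt0.
  rewrite scalerA; have -> // : mk h * a = e.
  by apply: val_inj; rewrite /= divfK.
Qed.

HB.instance Definition _ (x : cball B) :=
  GRing.isSubSemiModClosed.Build (nnreal R) B (local_pred x)
    (local_pred_closed x).

Record local_cone (x : cball B) := LocalCone {
  local_val :> B;
  _ : local_val \in local_pred x }.

HB.instance Definition _ x := [isSub for @local_val x].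
HB.instance Definition _ x := [Choice of local_cone x by <:].
HB.instance Definition _ x :=
  [SubChoice_isSubLSemiModule of local_cone x by <:].

Lemma local_addIr x (u u1 u2 : local_cone x) : u1 + u = u2 + u -> u1 = u2.
Proof.
move=> /(congr1 (@local_val x)) /= h.
by apply: val_inj; apply: precone_addIr h.
Qed.

Lemma local_add_eq0 x (u1 u2 : local_cone x) : u1 + u2 = 0 -> u1 = 0.
Proof.
move=> /(congr1 (@local_val x)) /= h.
by apply: val_inj; apply: precone_add_eq0 h.
Qed.

HB.instance Definition _ x :=
  isPrecone.Build R (local_cone x) (@local_addIr x) (@local_add_eq0 x).

Definition local_gauge (x : cball B) (u : B) : set R :=
  [set r | exists l : nnreal R,
    [/\ 0 < nnval l, cnorm ((x : B) + l *: u) <= 1 & r = (nnval l)^-1]].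

Definition local_norm (x : cball B) (u : local_cone x) : R :=
  inf (local_gauge x u).

Let gauge_inf x (u : local_cone x) : has_inf (local_gauge x u).
Proof.
split.
  case: u => u /= /asboolP[e e0 he].
  by exists (nnval e)^-1, e.
by exists 0 => _ [l [l0 _ ->]]; rewrite invr_ge0 ltW.
Qed.

Lemma local_norm_ge0 x (u : local_cone x) : 0 <= local_norm u.
Proof.
apply: lb_le_inf; first exact: (gauge_inf u).1.
by move=> _ [l [l0 _ ->]]; rewrite invr_ge0 ltW.
Qed.

Let local_norm_le x (u : local_cone x) (l : nnreal R) : 0 < nnval l ->
  cnorm ((x : B) + l *: (u : B)) <= 1 -> local_norm u <= (nnval l)^-1.
Proof. by move=> l0 h; apply: ge_inf; [exact: (gauge_inf u).2 | exists l]. Qed.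

Let local_norm_lt x (u : local_cone x) (l : nnreal R) : 0 < nnval l ->
  local_norm u < (nnval l)^-1 -> cnorm ((x : B) + l *: (u : B)) <= 1.
Proof.
move=> l0 /(inf_lt (gauge_inf u).1) [_ [d [d0 hd ->]]].
by rewrite ltf_pV2 ?posrE // => /ltW ld; apply: shrink hd.
Qed.

Let local_norm_leP x (u : local_cone x) (l : nnreal R) : 0 < nnval l ->
  local_norm u <= (nnval l)^-1 <-> cnorm ((x : B) + l *: (u : B)) <= 1.
Proof.
move=> l0; split; last exact: local_norm_le.
move=> h; apply/ler_addgt0Pr => e e0.
set K := cnorm (l *: (u : B)).
have K0 : 0 <= K by exact: cnorm_ge0.
set t := (1 + e / (K + 1))^-1.
have q0 : 0 < e / (K + 1) by rewrite divr_gt0 // ltr_wpDl.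
have t0 : 0 < t by rewrite invr_gt0 addr_gt0.
have t1 : t < 1 by rewrite invf_lt1 ?addr_gt0 // ltrDl.
have s0 : 0 <= 1 - t by rewrite subr_ge0 ltW.
have -> : l *: (u : B) = mk (ltW t0) *: (l *: (u : B))
                        + mk s0 *: (l *: (u : B)).
  rewrite -scalerDl -[LHS]scale1r; congr (_ *: _).
  by apply: val_inj; rewrite /= addrC subrK.
rewrite addrA; apply: le_trans (cnormD _ _) _; apply: lerD.
  rewrite scalerA; apply: local_norm_lt; first by rewrite /= mulr_gt0.
  apply: le_lt_trans h _; rewrite ltf_pV2 ?posrE //=; last by rewrite mulr_gt0.
  by rewrite gtr_pMl.
rewrite cnormZ /= -/K.
have tE : 1 - t = e / (K + 1) * t.
  apply/eqP; rewrite subr_eq addrC -[X in _ == X + _]mul1r -mulrDl.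
  by rewrite /t divff // gt_eqF // addr_gt0.
rewrite tE -(mulrA (e / (K + 1)) t K).
apply: (@le_trans _ _ (e / (K + 1) * K)).
  by rewrite ler_wpM2l ?(ltW q0) // ler_piMl // ltW.
rewrite -(mulrA e _ K) ler_piMr ?(ltW e0) // mulrC ler_pdivrMr ?ltr_wpDl //.
by rewrite mul1r lerDl.
Qed.

Lemma local_normP x (u : local_cone x) :
  local_norm u <= 1 <-> cnorm ((x : B) + (u : B)) <= 1.
Proof.
have := @local_norm_leP x u 1 ltr01.
by rewrite /= invr1 scale1r.
Qed.

Let local_norm_eps x (u : local_cone x) (e : R) : local_norm u < e ->
  exists l : nnreal R, [/\ 0 < nnval l, (nnval l)^-1 = e &
    cnorm ((x : B) + l *: (u : B)) <= 1].
Proof.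
move=> h; have e0 : 0 < e by apply: le_lt_trans h; exact: local_norm_ge0.
have i0 : 0 < e^-1 by rewrite invr_gt0.
exists (mk (ltW i0)); split => //=; first by rewrite invrK.
by apply: local_norm_lt; rewrite //= invrK.
Qed.

Lemma local_norm_eq0 x (u : local_cone x) : local_norm u = 0 -> u = 0.
Proof.
move=> u0; apply: val_inj => /=; apply: cnorm_eq0.
apply/eqP; rewrite eq_le cnorm_ge0 andbT.
apply/ler_addgt0Pr => e e0; rewrite add0r.
have [|l [l0 lE hl]] := @local_norm_eps x u e; first by rewrite u0.
have : cnorm (l *: (u : B)) <= 1.
  by apply: le_trans hl; rewrite addrC cnorm_le.
by rewrite cnormZ mulrC -ler_pdivlMr // mul1r lE.
Qed.

Lemma local_normD x (u v : local_cone x) :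
  local_norm (u + v) <= local_norm u + local_norm v.
Proof.
apply/ler_addgt0Pr => e e0.
have e20 : 0 < e / 2 by rewrite divr_gt0.
have [|d [d0 dE hd]] := @local_norm_eps x u (local_norm u + e / 2).
  by rewrite ltrDl.
have [|f [f0 fE hf]] := @local_norm_eps x v (local_norm v + e / 2).
  by rewrite ltrDl.
have S0 : 0 < (nnval d)^-1 + (nnval f)^-1 by rewrite addr_gt0 // invr_gt0.
have i0 : 0 < ((nnval d)^-1 + (nnval f)^-1)^-1 by rewrite invr_gt0.
have -> : local_norm u + local_norm v + e = (nnval (mk (ltW i0)))^-1.
  by rewrite /= invrK dE fE addrACA -splitr.
by apply: local_norm_le => //; apply: convex hd hf.
Qed.

Lemma local_norm_mono x (u v : local_cone x) :
  local_norm u <= local_norm (u + v).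
Proof.
apply: lb_le_inf; first exact: (gauge_inf (u + v)).1.
move=> _ [l [l0 hl ->]]; apply: local_norm_le => //.
by apply: le_trans hl; rewrite /= scalerDr addrA cnorm_le.
Qed.

Lemma local_normZ x (a : nnreal R) (u : local_cone x) :
  local_norm (a *: u) = nnval a * local_norm u.
Proof.
have key (b : nnreal R) (v : local_cone x) : 0 < nnval b ->
    local_norm (b *: v) <= nnval b * local_norm v.
  move=> b0; rewrite -ler_pdivrMl //.
  apply: lb_le_inf; first exact: (gauge_inf v).1.
  move=> _ [l [l0 hl ->]]; rewrite ler_pdivrMl //.
  have i0 : 0 < nnval l / nnval b by rewrite divr_gt0.
  have -> : nnval b / nnval l = (nnval (mk (ltW i0)))^-1.
    by rewrite /= invf_div.
  apply: local_norm_le => //=; rewrite scalerA.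
  have -> // : mk (ltW i0) * b = l.
  by apply: val_inj; rewrite /= divfK // gt_eqF.
have [a0|a0] := eqVneq (nnval a) 0.
  have -> : a = 0 by apply: val_inj.
  rewrite scale0r /= mul0r.
  apply/eqP; rewrite eq_le local_norm_ge0 andbT.
  apply/ler_addgt0Pr => e e0; rewrite add0r.
  have i0 : 0 < e^-1 by rewrite invr_gt0.
  rewrite -[e]invrK; apply: (@local_norm_le x 0 (mk (ltW i0))) => //.
  by rewrite /= scaler0 addr0 cball_norm.
have ap : 0 < nnval a by rewrite lt0r a0 nnval_ge0.
apply/eqP; rewrite eq_le key //=.
have i0 : 0 < (nnval a)^-1 by rewrite invr_gt0.
have := key (mk (ltW i0)) (a *: u) i0.
rewrite scalerA; have -> : mk (ltW i0) * a = 1.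
  by apply: val_inj; rewrite /= mulVf.
by rewrite scale1r /= -ler_pdivrMl ?invr_gt0 // invrK.
Qed.

Lemma local_leP x (u v : local_cone x) : cle u v <-> cle (u : B) (v : B).
Proof.
split; first by case=> w ->; exists (w : B).
case=> w vE; have wP : w \in local_pred x.
  have /asboolP[e e0 he] : (v : B) \in local_pred x by case: (v).
  apply/asboolP; exists e => //; apply: le_trans he.
  by rewrite vE scalerDr addrCA addrC cnorm_le.
by exists (LocalCone wP); apply: val_inj.
Qed.

Lemma local_lub x (s : nat -> local_cone x) :
  (forall n, cle (s n) (s n.+1)) -> (forall n, local_norm (s n) <= 1) ->
  exists l, [/\ forall n, cle (s n) l,
                forall y, (forall n, cle (s n) y) -> cle l y
              & local_norm l <= 1].
Proof.
move=> s_incr s1.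
have addl (y z : B) : cle y z -> cle ((x : B) + y) ((x : B) + z).
  by case=> w ->; exists w; rewrite addrA.
have cancell (y z : B) : cle ((x : B) + y) ((x : B) + z) -> cle y z.
  case=> w h; exists w; apply: (precone_addIr (x : B)).
  by rewrite addrC h -addrA addrC.
have [||m [ub lub m1]] := cone_lub (fun n => (x : B) + (s n : B)).
- by move=> n; apply/addl/local_leP.
- by move=> n; apply/local_normP.
have [l mE] : cle (x : B) m.
  by case: (ub 0%N) => w ->; exists ((s 0%N : B) + w); rewrite addrA.
subst m.
have lP : l \in local_pred x.
  by apply/asboolP; exists 1; rewrite ?scale1r //= ltr01.
exists (LocalCone lP); split.
- by move=> n; apply/local_leP/cancell/ub.
- move=> y uby; apply/local_leP/cancell/lub => n; apply: addl.
  exact/local_leP.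
- exact/local_normP.
Qed.

HB.instance Definition _ x :=
  Precone_isCone.Build R (local_cone x) (@local_norm_ge0 x) (@local_normZ x)
    (@local_norm_eq0 x) (@local_normD x) (@local_norm_mono x) (@local_lub x).

Lemma cball_shift_subproof (u : cball B) (v : cball (local_cone u)) :
  cnorm (local_val (cball_val v) + (u : B)) <= 1.
Proof. by rewrite addrC; apply/local_normP; case: v. Qed.

Definition cball_shift (u : cball B) (v : cball (local_cone u)) : cball B :=
  CBall (cball_shift_subproof v).

Lemma cball_forget_subproof (u : cball B) (v : cball (local_cone u)) :
  cnorm (local_val (cball_val v)) <= 1.
Proof. exact: le_trans (cnorm_le _ _) (cball_shift_subproof v). Qed.

Definition cball_forget (u : cball B) (v : cball (local_cone u)) : cball B :=
  CBall (cball_forget_subproof v).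

Lemma cball_subsum_subproof n (x : B) (u : 'I_n -> B)
  (h : cnorm (x + \sum_(i < n) u i) <= 1) (I : {set 'I_n}) :
  cnorm (x + \sum_(i in I) u i) <= 1.
Proof.
apply: le_trans h; rewrite [X in _ <= cnorm (_ + X)](bigID (mem I)) /= addrA.
exact: cnorm_le.
Qed.

Definition cball_subsum n (x : B) (u : 'I_n -> B)
    (h : cnorm (x + \sum_(i < n) u i) <= 1) (I : {set 'I_n}) : cball B :=
  CBall (cball_subsum_subproof h I).

End local_cone.

Definition cincreasing (R : realType) (B C : coneType R) (f : cball B -> C) :=
  forall x y : cball B, cle (x : B) (y : B) -> cle (f x) (f y).

Definition totally_monotonic (R : realType) (B C : coneType R)
    (f : cball B -> C) :=
  forall (n : nat) (x : B) (u : 'I_n -> B)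
    (h : cnorm (x + \sum_(i < n) u i) <= 1),
    cle (\sum_(I : {set 'I_n} | odd (n - #|I|)) f (cball_subsum h I))
        (\sum_(I : {set 'I_n} | ~~ odd (n - #|I|)) f (cball_subsum h I)).

(* For increasing [f] the [csub] here is a genuine difference, since
   [cball_forget x] lies below [cball_shift x] in [B]. *)
Definition cdelta (R : realType) (B C : coneType R) (f : cball B -> C)
    (u : cball B) : cball (local_cone u) -> C :=
  fun x => csub (f (cball_shift x)) (f (cball_forget x)).

Fixpoint n_increasing (R : realType) (C : coneType R) (n : nat)
    (B : coneType R) (f : cball B -> C) {struct n} : Prop :=
  match n with
  | 0%N => cincreasing f
  | m.+1 => cincreasing f /\
      forall u : cball B, @n_increasing R C m (local_cone u) (cdelta f (u := u))
  end.

(* Main.v *)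
(** Splitting the subsets of [{0, ..., n}] according to whether they contain [0]
    shows that, for an increasing [f], the inequality of total monotonicity of
    [f] at [x, u_0, ..., u_n] is the one of [cdelta f] (for [u := u_0]) at
    [x, u_1, ..., u_n] with the sum of all [f (x + \sum_(i in J) u_i)], [J] a
    subset of [{1, ..., n}], added to both sides. *)
Require Import Defs.
From mathcomp Require Import boolp classical_sets.
From mathcomp Require Import all_boot all_order all_algebra reals.

Set Implicit Arguments.
Unset Strict Implicit.
Unset Printing Implicit Defensive.

Import Order.TTheory Num.Theory GRing.Theory.
Local Open Scope ring_scope.

Section SubsetsOfOrdinals.
Variable n : nat.

Definition lift_set (J : {set 'I_n}) : {set 'I_n.+1} := lift ord0 @: J.

Lemma ord0_notin_lift_set (J : {set 'I_n}) : ord0 \notin lift_set J.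
Proof. by apply/imsetP => -[j _ /eqP]; rewrite (negPf (neq_lift _ _)). Qed.

Lemma card_lift_set (J : {set 'I_n}) : #|lift_set J| = #|J|.
Proof. by rewrite card_imset //; exact: lift_inj. Qed.

Lemma card_setU1_lift_set (J : {set 'I_n}) : #|ord0 |: lift_set J| = #|J|.+1.
Proof. by rewrite cardsU1 ord0_notin_lift_set card_lift_set. Qed.

Lemma lift_setK : cancel lift_set (fun I => lift ord0 @^-1: I).
Proof.
by move=> J; apply/setP => j; rewrite inE mem_imset //; exact: lift_inj.
Qed.

Lemma setU1_lift_setK :
  cancel (fun J => ord0 |: lift_set J) (fun I => lift ord0 @^-1: I).
Proof.
move=> J; apply/setP => j; rewrite !inE eq_sym (negPf (neq_lift _ _)) /=.
by rewrite mem_imset //; exact: lift_inj.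
Qed.

Lemma lift_set_preim (I : {set 'I_n.+1}) :
  lift_set (lift ord0 @^-1: I) = I :\ ord0.
Proof.
apply/setP => i; rewrite !inE; case: (unliftP ord0 i) => [j ->|->].
  by rewrite eq_sym neq_lift mem_imset ?inE //; exact: lift_inj.
by rewrite eqxx (negPf (ord0_notin_lift_set _)).
Qed.

(** A subset of ['I_n.+1] either avoids [ord0] or contains it; on each of the two classes, preimage
    under [lift ord0] inverts the reindexing by [J]. *)
Lemma big_lift_set (V : nmodType) (P : pred {set 'I_n.+1})
    (g : {set 'I_n.+1} -> V) :
  \sum_(I | P I) g I = \sum_(J | P (lift_set J)) g (lift_set J)
    + \sum_(J | P (ord0 |: lift_set J)) g (ord0 |: lift_set J).
Proof.
rewrite (bigID (fun I : {set 'I_n.+1} => ord0 \notin I)) /=; congr (_ + _).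
  rewrite (reindex_onto lift_set (fun I => lift ord0 @^-1: I)) /=.
    by apply: eq_bigl => J; rewrite ord0_notin_lift_set lift_setK eqxx !andbT.
  move=> I /andP[_ nI0]; rewrite lift_set_preim; apply/setP => i; rewrite !inE.
  by case: eqP => // ->; rewrite (negPf nI0).
rewrite (reindex_onto (fun J => ord0 |: lift_set J)
           (fun I => lift ord0 @^-1: I)) /=.
  by apply: eq_bigl => J; rewrite setU1_lift_setK setU11 eqxx !andbT.
by move=> I /andP[_ /negPn I0]; rewrite lift_set_preim setD1K.
Qed.

Lemma big_setU1_lift_set (V : nmodType) (u : 'I_n.+1 -> V) (J : {set 'I_n}) :
  \sum_(i in ord0 |: lift_set J) u i = u ord0 + \sum_(j in J) u (lift ord0 j).
Proof.
rewrite big_setU1 ?ord0_notin_lift_set //= big_imset //.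
by move=> i j _ _; exact: lift_inj.
Qed.

(** Parity flips because [#|J| <= n], so the truncated subtraction really grows by one. *)
Lemma odd_subSn_card (J : {set 'I_n}) :
  odd (n.+1 - #|J|) = ~~ odd (n - #|J|).
Proof. by rewrite subSn // -[X in (_ <= X)%N]card_ord max_card. Qed.

End SubsetsOfOrdinals.

Section Precones.
Variables (R : realType) (P : preconeType R).

Lemma cle_add2l (z x y : P) : cle (z + x) (z + y) <-> cle x y.
Proof.
split=> -[w e]; exists w; last by rewrite e addrA.
by apply: (precone_addIr z); rewrite addrC e -addrA addrC.
Qed.

Lemma csubK (x y : P) : cle x y -> x + csub y x = y.
Proof. by case=> z yE; rewrite /csub; case: xgetP => [w _ /= ->|/(_ z)]. Qed.

End Precones.

(** A single instance of total monotonicity, isolated because [n_increasing n f] is used to derive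
    the instances with exactly [n] increments. *)
Definition tm_ineq (R : realType) (B C : coneType R) (f : cball B -> C)
    n (x : B) (u : 'I_n -> B)
    (h : cnorm (x + \sum_(i < n) u i) <= 1) : Prop :=
  cle (\sum_(I : {set 'I_n} | odd (n - #|I|)) f (cball_subsum h I))
      (\sum_(I : {set 'I_n} | ~~ odd (n - #|I|)) f (cball_subsum h I)).

(** The only subset of ['I_0] counts as even, so the left-hand sum is empty. *)
Lemma tm_ineq0 (R : realType) (B C : coneType R) (f : cball B -> C) (x : B)
    (u : 'I_0 -> B) (h : cnorm (x + \sum_(i < 0) u i) <= 1) : tm_ineq f h.
Proof.
by rewrite /tm_ineq big_pred0 //; exact: ex_intro (esym (add0r _)).
Qed.

(** The family [w] is tied to [u] and [v] by equations only, so that it can be built from them in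
    one direction of the theorem and given in advance in the other. *)
Lemma tm_ineqS (R : realType) (B C : coneType R) (f : cball B -> C)
    (u : cball B) n (x : local_cone u) (v : 'I_n -> local_cone u)
    (h : cnorm (x + \sum_(i < n) v i) <= 1)
    (w : 'I_n.+1 -> B) (h' : cnorm ((x : B) + \sum_(i < n.+1) w i) <= 1) :
  cincreasing f -> w ord0 = u -> (forall i, w (lift ord0 i) = v i) ->
  tm_ineq f h' <-> tm_ineq (cdelta f (u := u)) h.
Proof.
move=> f_incr w0 wS; pose z J := cball_subsum h J.
have zE J :
    local_val (cball_val (z J)) = (x : B) + \sum_(j in J) w (lift ord0 j).
  rewrite /= (big_morph (@local_val _ _ _) (fun _ _ => erefl) erefl).
  by congr (_ + _); apply: eq_bigr => j _; rewrite wS.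
have forgetE J : cball_subsum h' (lift_set J) = cball_forget (z J).
  apply: val_inj; rewrite [RHS]zE /= big_imset //.
  by move=> i j _ _; exact: lift_inj.
have shiftE J : cball_subsum h' (ord0 |: lift_set J) = cball_shift (z J).
  apply: val_inj; rewrite [RHS](congr1 (+%R^~ (u : B)) (zE J)) /=.
  by rewrite big_setU1_lift_set w0 addrCA addrC.
have f_shift J :
    f (cball_shift (z J)) = f (cball_forget (z J)) + cdelta f (z J).
  by rewrite csubK //; apply: f_incr; exists (u : B).
pose S := \sum_J f (cball_forget (z J)).
pose D (P : pred {set 'I_n}) := \sum_(J | P J) cdelta f (z J).
(* Sets without [ord0] give [f (cball_forget (z J))] for [J] outside [Q]; sets with [ord0] give the
   same term plus [cdelta f (z J)] for [J] in [Q]. The first kind of term thus ranges over all [J]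
   and sums to [S], whatever [Q] is. *)
have split_sum (P : pred {set 'I_n.+1}) (Q : pred {set 'I_n}) :
    (forall J, P (lift_set J) = ~~ Q J) ->
    (forall J, P (ord0 |: lift_set J) = Q J) ->
    \sum_(I | P I) f (cball_subsum h' I) = S + D Q.
  move=> PQ PQ'; rewrite big_lift_set (eq_bigl _ _ PQ) (eq_bigl _ _ PQ').
  rewrite (eq_bigr _ (fun J _ => congr1 f (forgetE J))).
  rewrite (eq_bigr _ (fun J _ => etrans (congr1 f (shiftE J)) (f_shift J))).
  by rewrite big_split addrA [S](bigID Q) /= [X in _ = X + _]addrC.
rewrite /tm_ineq (split_sum _ (fun J => odd (n - #|J|))).
- rewrite (split_sum _ (fun J => ~~ odd (n - #|J|))); first exact: cle_add2l.
    by move=> J; rewrite card_lift_set odd_subSn_card.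
  by move=> J; rewrite card_setU1_lift_set subSS.
- by move=> J; rewrite card_lift_set odd_subSn_card.
- by move=> J; rewrite card_setU1_lift_set subSS.
Qed.

(** This is the case of one increment, the difference [z] of [y] and [x]. *)
Lemma tm_increasing (R : realType) (B C : coneType R) (f : cball B -> C) :
  totally_monotonic f -> cincreasing f.
Proof.
move=> tmf x y [z yE].
have h : cnorm ((x : B) + \sum_(i < 1) z) <= 1.
  by rewrite big_ord1 -yE cball_norm.
have sum0 (P : pred {set 'I_0}) (g : {set 'I_0} -> C) :
    \sum_(J | P J) g J = if P set0 then g set0 else 0.
  rewrite big_mkcond (big_pred1 set0) // => J.
  by apply/esym/eqP/setP => -[].
have := tmf 1%N x (fun=> z) h.
rewrite !big_lift_set !sum0 !card_lift_set !card_setU1_lift_set !cards0 /=.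
(* The empty set has odd complement and yields [f x] on the left; [{ord0}] yields [f y] on the
   right. *)
rewrite addr0 add0r; congr (cle (f _) (f _)); apply: val_inj => /=.
  by rewrite big_imset ?big_set0 ?addr0 // => -[].
by rewrite big_setU1_lift_set big_set0 addr0.
Qed.

Lemma tm_cdelta (R : realType) (B C : coneType R) (f : cball B -> C)
    (u : cball B) :
  totally_monotonic f -> totally_monotonic (cdelta f (u := u)).
Proof.
move=> tmf n x v h.
(* The base point [u] becomes increment number 0, in front of the [v j]. *)
pose w (i : 'I_n.+1) := if unlift ord0 i is Some j then (v j : B) else u.
have w0 : w ord0 = u by rewrite /w unlift_none.
have wS i : w (lift ord0 i) = v i by rewrite /w liftK.
have h' : cnorm ((x : B) + \sum_(i < n.+1) w i) <= 1.
  rewrite big_ord_recl w0 (eq_bigr _ (fun i _ => wS i)) addrCA.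
  move/local_normP: h.
  by rewrite /= (big_morph (@local_val _ _ _) (fun _ _ => erefl) erefl).
by apply/(tm_ineqS h h' (tm_increasing tmf) w0 wS)/tmf.
Qed.

Lemma mem_local_pred (R : realType) (B : coneType R) (u : cball B) (x : B) :
  cnorm ((u : B) + x) <= 1 -> x \in local_pred u.
Proof. by move=> h; apply/asboolP; exists 1; rewrite ?scale1r //= ltr01. Qed.

(** The induction on [n] generalizes [B], since [cdelta f] lives on the local cone at [u]. *)
Lemma tm_n_increasing (R : realType) (C : coneType R) n (B : coneType R)
    (f : cball B -> C) : totally_monotonic f -> n_increasing n f.
Proof.
elim: n B f => [|n IHn] B f tmf; first exact: tm_increasing.
by split=> [|u]; [exact: tm_increasing|exact/IHn/tm_cdelta].
Qed.

Lemma n_increasing_tm_ineq (R : realType) (C : coneType R) n (B : coneType R)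
    (f : cball B -> C) (x : B) (w : 'I_n -> B)
    (h : cnorm (x + \sum_(i < n) w i) <= 1) :
  n_increasing n f -> tm_ineq f h.
Proof.
elim: n B f x w h => [|n IHn] B f x w h; first by move=> _; exact: tm_ineq0.
case=> f_incr df_incr.
have sumE : x + \sum_i w i = w ord0 + (x + \sum_(i < n) w (lift ord0 i)).
  by rewrite big_ord_recl addrCA.
have w0_ball : cnorm (w ord0) <= 1.
  by apply: le_trans h; rewrite sumE cnorm_le.
(* The first increment serves as base point. Adding [x] or any other increment to it stays below the
   full sum, hence in the unit ball, so these are all vectors of the local cone at [u]. *)
pose u := CBall w0_ball.
have x_local : x \in local_pred u.
  by apply: mem_local_pred; apply: le_trans h; rewrite sumE addrA cnorm_le.
have w_local i : w (lift ord0 i) \in local_pred u.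
  apply: mem_local_pred; apply: le_trans h.
  rewrite sumE (bigD1 i) //= (addrCA x) (addrA (w ord0)); exact: cnorm_le.
pose v i := LocalCone (w_local i).
have h' : cnorm (LocalCone x_local + \sum_(i < n) v i) <= 1.
  apply/local_normP; move: h; rewrite sumE /=.
  by rewrite (big_morph (@local_val _ _ _) (fun _ _ => erefl) erefl).
exact/(tm_ineqS (x := LocalCone x_local) h' h f_incr erefl
         (fun=> erefl))/IHn/df_incr.
Qed.

Theorem theorem7p19 (R : realType) (B C : coneType R) (f : cball B -> C) :
  totally_monotonic f <-> forall n : nat, n_increasing n f.
Proof.
split=> [tmf n|f_incr n x u h]; first exact: tm_n_increasing.
(* The inequality with [n] increments comes from the hypothesis at that same [n]. *)
exact/n_increasing_tm_ineq/f_incr.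
Qed.
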